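(* Let $n$ be an integer greater than $1$. Let $X=\{b_1,\dots,b_n\}$ be a set of cardinality $n$. Let $\mathcal{O}=\{(a_i,b_i)\mid 1\leq i\leq n\}$ be a subset of $X^2$, where $\{a_1,\dots,a_n\}=X$ and $a_i\neq b_i$ for $1\leq i\leq n$. Let $r_0\in \mathrm{Sym}_{\mathcal{O}}$ be the cyclic permutation of order $n$ given by $$(a_1,b_1)\mapsto (a_2,b_2)\mapsto\cdots\mapsto (a_n,b_n)\mapsto (a_1,b_1).$$ Then there exists an extension $r\colon X\times X\to X\times X$ of $r_0$ such that $(X,r)$ is a $2$-cancellative square-free $\mathrm{SD}$ braided set, with $r(x,y)=(\sigma_x(y),x)$ and $\sigma_x^2=\mathrm{id}$ for all $x\in X$, if and only if $a_n=b_1$ and $a_i=b_{i+1}$ for $1\leq i\leq n-1$. Furthermore, in this case, if $n$ is odd then $(X,r)$ is unique.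
   Context: A quadratic set $(X,r)$ is a nonempty set $X$ with a bijective map $r\colon X\times X\to X\times X$, written $r(x,y)=(\sigma_x(y),\gamma_y(x))$. It is square-free if $r(x,x)=(x,x)$ for all $x\in X$, and $\mathrm{SD}$ if all $\gamma_y=\mathrm{id}$, i.e. $r(x,y)=(\sigma_x(y),x)$. It is a braided set if $r_1r_2r_1=r_2r_1r_2$ on $X^3$, where $r_1=r\times \mathrm{id}_X$ and $r_2=\mathrm{id}_X\times r$. The structure monoid is $M(X,r)=\langle X\mid xy=\sigma_x(y)\gamma_y(x),\ x,y\in X\rangle$. The quadratic set is $2$-cancellative if for all $x,y,z\in X$, each of the equalities $xy=xz$ or $yx=zx$ in $M(X,r)$ implies $y=z$. $\mathrm{Sym}_{\mathcal{O}}$ is the group of permutations of $\mathcal{O}$. That $r$ is an extension of $r_0$ means that the restriction of $r$ to $\mathcal{O}$ is $r_0$. *)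

(* Defs.v *)
From HB Require Import structures.
From mathcomp Require Import all_boot perm.
From mathcomp Require Import boolp.

Set Implicit Arguments.
Unset Strict Implicit.
Unset Printing Implicit Defensive.

Local Open Scope group_scope.
Local Open Scope quotient_scope.

Section QuadraticSets.
Variables (X : Type) (r : X * X -> X * X).

Definition sigma (x y : X) : X := (r (x, y)).1.
Definition gamma (y x : X) : X := (r (x, y)).2.

Definition quadratic_set : Prop := inhabited X /\ bijective r.

Definition square_free : Prop := forall x, r (x, x) = (x, x).

Definition is_SD : Prop := forall y, gamma y =1 id.

(* X^3 is encoded as (X * X) * X. *)
Definition r1 (p : X * X * X) : X * X * X := (r p.1, p.2).
Definition r2 (p : X * X * X) : X * X * X :=
  let q := r (p.1.2, p.2) in (p.1.1, q.1, q.2).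

Definition braided_set : Prop :=
  quadratic_set /\ r1 \o r2 \o r1 =1 r2 \o r1 \o r2.

(* The congruence on the free monoid of words over X generated by the
   defining relations xy = sigma_x(y) gamma_y(x). *)
Inductive word_eq : seq X -> seq X -> Prop :=
| word_eq_gen x y : word_eq [:: x; y] [:: sigma x y; gamma y x]
| word_eq_refl s : word_eq s s
| word_eq_sym s t : word_eq s t -> word_eq t s
| word_eq_trans t s u : word_eq s t -> word_eq t u -> word_eq s u
| word_eq_cat s s' t t' :
    word_eq s s' -> word_eq t t' -> word_eq (s ++ t) (s' ++ t').

End QuadraticSets.

Section StructureMonoid.
Variables (X : choiceType) (r : X * X -> X * X).

Definition word_eqb : rel (seq X) := fun s t => `[< word_eq r s t >].

Lemma word_eqb_refl : reflexive word_eqb.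
Proof. by move=> s; apply/asboolP; exact: word_eq_refl. Qed.

Lemma word_eqb_sym : symmetric word_eqb.
Proof.
by move=> s t; apply/asboolP/asboolP => ?; exact: word_eq_sym.
Qed.

Lemma word_eqb_trans : transitive word_eqb.
Proof.
by move=> t s u /asboolP st /asboolP tu; apply/asboolP; exact: word_eq_trans tu.
Qed.

Canonical word_equiv :=
  EquivRel word_eqb word_eqb_refl word_eqb_sym word_eqb_trans.

Definition structure_monoid := {eq_quot word_equiv}.

HB.instance Definition _ := Choice.on structure_monoid.
HB.instance Definition _ := EqQuotient.on structure_monoid.

Definition sm_word (s : seq X) : structure_monoid := \pi_structure_monoid s.
Definition sm_gen (x : X) : structure_monoid := sm_word [:: x].
Definition sm_mul (u v : structure_monoid) : structure_monoid :=
  sm_word (repr u ++ repr v).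

Lemma sm_wordP s t : sm_word s = sm_word t <-> word_eq r s t.
Proof.
by split=> [/eqquotP/asboolP // | st]; apply/eqquotP/asboolP.
Qed.

Lemma sm_wordK u : sm_word (repr u) = u.
Proof. exact: reprK. Qed.

Lemma sm_word_cat s t : sm_mul (sm_word s) (sm_word t) = sm_word (s ++ t).
Proof. by apply/sm_wordP/word_eq_cat; apply/sm_wordP; rewrite sm_wordK. Qed.

Lemma sm_mulA : associative sm_mul.
Proof.
move=> u v w; rewrite -(sm_wordK u) -(sm_wordK v) -(sm_wordK w).
by rewrite !sm_word_cat catA.
Qed.

Lemma sm_mul1 : left_id (sm_word [::]) sm_mul.
Proof. by move=> u; rewrite -(sm_wordK u) sm_word_cat. Qed.

Lemma sm_mulr1 : right_id (sm_word [::]) sm_mul.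
Proof. by move=> u; rewrite -(sm_wordK u) sm_word_cat cats0. Qed.

HB.instance Definition _ :=
  isMonoid.Build structure_monoid sm_mulA sm_mul1 sm_mulr1.

Definition two_cancellative : Prop :=
  forall x y z : X,
    (sm_gen x * sm_gen y = sm_gen x * sm_gen z -> y = z) /\
    (sm_gen y * sm_gen x = sm_gen z * sm_gen x -> y = z).

End StructureMonoid.

Section Extensions.
Variables (X : finType) (O : {set X * X}) (r0 : {perm X * X}).
Variable r : X * X -> X * X.

(* A member of Sym_O is encoded as a permutation of X * X with support in O;
   only its values on O matter here. *)
Definition extends : Prop := {in O, r =1 r0}.

Definition admissible_extension : Prop :=
  extends /\
  [/\ two_cancellative r, square_free r, is_SD r, braided_set r
    & forall x, involutive (sigma r x)].

End Extensions.

(* Main.v *)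
Require Import Defs.
From mathcomp Require Import all_boot perm.
From mathcomp Require Import ssralg zmodp ring boolp.

(** For an SD quadratic set the braid equation says that the operation
    [sigma x y] is left self-distributive, so square-free SD braided sets with
    involutive [sigma x] are exactly the involutory quandles (keis).

    Necessity of [a i = b (ordS i)] is immediate: the second component of
    [r (a i, b i)] is [a i] because [r] is SD, and it is [b (ordS i)] because
    [r] extends the cycle.

    For sufficiency, use [b] to index [X] by Z/n, so that the cycle reads
    [(i + 1, i) -> (i + 2, i + 1)].  The dihedral quandle
    [sigma i j = 2 i - j] extends it.  Its defining relations preserve the
    alternating sum [x1 - x2 + x3 - ...] of a word ([word_eq_alternating_sum]),
    and already for words of length two this invariant separates [xy] from
    [xz], and [yx] from [zx], when [y <> z]; hence two-cancellativity.

    For uniqueness, let [s] be any kei operation on Z/n with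
    [s (i + 1) i = i + 2].  Self-distributivity makes the composite
    [s (i + 1) \o s i] independent of [i]; its value at [i] is [i + 2], so it
    is the translation by 2.  Conjugating by the involution [s i] inverts this
    translation, so [s i (j + 2) = s i j - 2].  Starting from [s i i = i], this
    gives [s i j = 2 i - j] whenever [j - i] is a multiple of 2, which for odd
    [n] is no restriction ([kei_dihedral]). *)

Set Implicit Arguments.
Unset Strict Implicit.
Unset Printing Implicit Defensive.

Import GRing.Theory.

Section AlternatingSum.
Local Open Scope ring_scope.
Variables (X : Type) (R : pzRingType) (c : X -> R).

Definition alternating_sum (s : seq X) : R := foldr (fun x v => c x - v) 0 s.

Lemma alternating_sum_cat s t :
  alternating_sum (s ++ t) =
  alternating_sum s + (-1) ^+ size s * alternating_sum t.
Proof.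
elim: s => [|x s IHs] /=; first by rewrite add0r mul1r.
by rewrite IHs exprS mulN1r mulNr opprD addrA.
Qed.

(** The sign with which a suffix enters depends on the length of the prefix,
    so the invariance of the length has to be carried through the induction
    over the congruence. *)
Lemma word_eq_alternating_sum (r : X * X -> X * X) :
    (forall x y, c (sigma r x y) - c (gamma r y x) = c x - c y) ->
  forall s t, word_eq r s t ->
    size s = size t /\ alternating_sum s = alternating_sum t.
Proof.
move=> cr s t; elim=> {s t} //.
- by move=> x y; rewrite /alternating_sum /= !subr0 cr.
- by move=> s t _ [-> ->].
- by move=> s t u _ [-> ->] _ [-> ->].
- move=> s s' t t' _ [ss es] _ [st et].
  by rewrite !size_cat !alternating_sum_cat ss st es et.
Qed.

End AlternatingSum.

Section TwoCancellative.
Local Open Scope ring_scope.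

(** In words of length two the alternating sum is a difference, and one of the
    two letters is determined by the other and their difference. *)
Lemma difference_two_cancellative (X : choiceType) (R : pzRingType)
    (c : X -> R) (r : X * X -> X * X) :
    injective c ->
    (forall x y, c (sigma r x y) - c (gamma r y x) = c x - c y) ->
  two_cancellative r.
Proof.
move=> c_inj cr x y z; rewrite /sm_gen.
split; rewrite [LHS]sm_word_cat [RHS]sm_word_cat
  => /sm_wordP /(word_eq_alternating_sum cr) [_];
  rewrite /alternating_sum /= !subr0.
- by move/addrI/oppr_inj/c_inj.
- by move/addIr/c_inj.
Qed.

End TwoCancellative.

Lemma SD_E (X : Type) (r : X * X -> X * X) :
  is_SD r -> forall x y, r (x, y) = (sigma r x y, x).
Proof. by move=> SD x y; rewrite [LHS]surjective_pairing -/(gamma r y x) SD. Qed.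

(** The first component of the braid equation is left self-distributivity; the
    two other components hold for every SD set. *)
Lemma SD_braidP (X : Type) (r : X * X -> X * X) : is_SD r ->
  r1 r \o r2 r \o r1 r =1 r2 r \o r1 r \o r2 r <->
  (forall x y z, sigma r (sigma r x y) (sigma r x z) =
                 sigma r x (sigma r y z)).
Proof.
move=> SD; split=> [braid x y z | dist [[x y] z]].
  by have := braid (x, y, z); rewrite /r1 /r2 /= !(SD_E SD) /= => -[].
by rewrite /r1 /r2 /= !(SD_E SD) /= dist.
Qed.

(** An inverse of [(x, y) -> (sigma x y, x)] is [(u, v) -> (v, sigma v u)]. *)
Lemma SD_involutive_bijective (X : Type) (r : X * X -> X * X) :
  is_SD r -> (forall x, involutive (sigma r x)) -> bijective r.
Proof.
move=> SD invo; exists (fun p => (p.2, sigma r p.2 p.1)) => -[x y] /=;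
  by rewrite (SD_E SD) /= invo.
Qed.

Lemma ordS_Zp n (i : 'I_n.+2) : ordS i = (i + 1)%R.
Proof. by apply: val_inj; rewrite /= addn1. Qed.

Section KeiOnZn.
Local Open Scope ring_scope.
Variables (n : nat) (s : 'I_n.+2 -> 'I_n.+2 -> 'I_n.+2).
Hypothesis s_idem : forall i, s i i = i.
Hypothesis s_invo : forall i, involutive (s i).
Hypothesis s_dist : forall i j k, s (s i j) (s i k) = s i (s j k).
Hypothesis s_step : forall i, s (i + 1) i = i + 2%:R.

(** Self-distributivity at the pair [(i + 1, i)], whose product is [i + 2]. *)
Lemma s_comp_const i j : s (i + 1 + 1) (s (i + 1) j) = s (i + 1) (s i j).
Proof. by rewrite -addrA -(s_step i) s_dist. Qed.

(** The composite does not depend on [i], and at [i = j] its value is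
    [s (j + 1) j]; every [i] is reached from [j] by steps of 1. *)
Lemma s_comp_translation i j : s (i + 1) (s i j) = j + 2%:R.
Proof.
have const k : s (j + k%:R + 1) (s (j + k%:R) j) = j + 2%:R.
  elim: k => [|k IHk]; first by rewrite addr0 s_idem s_step.
  by rewrite -natr1 addrA s_comp_const.
by have := const (i - j : 'I_n.+2); rewrite natr_Zp [j + _]addrC subrK.
Qed.

(** Conjugation by the involution [s i] exchanges [s (i + 1) \o s i] and
    [s i \o s (i + 1)], that is, the translation by 2 and its inverse. *)
Lemma s_shift i j : s i (j + 2%:R) = s i j - 2%:R.
Proof.
apply/eqP; rewrite eq_sym subr_eq eq_sym; apply/eqP.
by rewrite -(s_comp_translation i) s_invo -(s_comp_translation i) s_invo.
Qed.

(** For even order only the [j] of the same parity as [i] would be reached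
    from [s i i = i] by shifts of 2. *)
Lemma kei_dihedral : odd n.+2 -> forall i j, s i j = i + i - j.
Proof.
move=> n_odd i j.
have even_shift k : s i (i + 2%:R *+ k) = i - 2%:R *+ k.
  elim: k => [|k IHk]; first by rewrite mulr0n subr0 addr0 s_idem.
  by rewrite mulrSr addrA s_shift IHk -addrA -opprD.
(* Modulo an odd N, half of a residue m is m * (N + 1) / 2; here N = n.+2. *)
have -> : j = i + 2%:R *+ ((j - i)%R * n.+3./2).
  have double_half : (2 * n.+3./2 = n.+3)%N.
    by rewrite mul2n even_halfK // oddS n_odd.
  rewrite -mulrnA mulnCA double_half natrM natr_Zp -natr1 (@pchar_Zp n.+2) //.
  by rewrite add0r mulr1 addrC subrK.
by rewrite even_shift; ring.
Qed.

End KeiOnZn.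

Section DihedralSet.
Local Open Scope ring_scope.
Variables (n : nat) (X : finType) (b : 'I_n.+2 -> X) (c : X -> 'I_n.+2).
Hypotheses (bK : cancel b c) (cK : cancel c b).

Definition dihedral_map (p : X * X) : X * X := (b (c p.1 + c p.1 - c p.2), p.1).

Lemma dihedral_SD : is_SD dihedral_map. Proof. by []. Qed.

Lemma dihedral_involutive x : involutive (sigma dihedral_map x).
Proof. by move=> y; rewrite /sigma /= bK -[RHS]cK; congr b; ring. Qed.

Lemma dihedral_square_free : square_free dihedral_map.
Proof. by move=> x; rewrite /dihedral_map /= addrK cK. Qed.

Lemma dihedral_braided : braided_set dihedral_map.
Proof.
split.
  split; first exact: inhabits (b 0).
  exact: SD_involutive_bijective dihedral_SD dihedral_involutive.
apply/(SD_braidP dihedral_SD) => x y z.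
by rewrite /sigma /= !bK; congr b; ring.
Qed.

Lemma dihedral_two_cancellative : two_cancellative dihedral_map.
Proof.
apply: (difference_two_cancellative (can_inj cK)) => x y.
by rewrite /sigma /gamma /= bK; ring.
Qed.

Lemma dihedral_admissible (O : {set X * X}) (r0 : {perm X * X}) :
    O = [set (b (i + 1), b i) | i : 'I_n.+2] ->
    (forall i, r0 (b (i + 1), b i) = (b (i + 1 + 1), b (i + 1))) ->
  admissible_extension O r0 dihedral_map.
Proof.
move=> defO r0E; split.
  move=> p; rewrite defO => /imsetP[i _ ->].
  by rewrite r0E /dihedral_map /= !bK; congr (b _, _); ring.
split; [exact: dihedral_two_cancellative | exact: dihedral_square_free
  | exact: dihedral_SD | exact: dihedral_braided | exact: dihedral_involutive].
Qed.

Lemma admissible_dihedral (O : {set X * X}) (r0 : {perm X * X}) r :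
    O = [set (b (i + 1), b i) | i : 'I_n.+2] ->
    (forall i, r0 (b (i + 1), b i) = (b (i + 1 + 1), b (i + 1))) ->
    odd n.+2 -> admissible_extension O r0 r ->
  r = dihedral_map.
Proof.
move=> defO r0E n_odd [ext [_ sqf SD [_ /(SD_braidP SD) dist] invo]].
pose s i j := c (sigma r (b i) (b j)).
have sE : forall i j, s i j = i + i - j.
  apply: kei_dihedral n_odd; rewrite /s.
  - by move=> i; rewrite /sigma sqf bK.
  - by move=> i j; rewrite cK invo bK.
  - by move=> i j k; rewrite !cK dist.
  - move=> i; rewrite /sigma ext ?r0E /= ?bK; first by ring.
    by rewrite defO; apply/imsetP; exists i.
apply: funext => -[x y]; rewrite (SD_E SD) /dihedral_map /=.
by rewrite -sE /s !cK.
Qed.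

End DihedralSet.

(* The indices 1..n are the elements 0..n-1 of 'I_n, and [ordS] is the cyclic
   successor, so that [a i = b (ordS i)] at the last index reads a_n = b_1. *)
Theorem proposition6p2 (n : nat) (n_gt1 : 1 < n)
    (X : finType) (cardX : #|X| = n)
    (a b : 'I_n -> X)
    (a_onto : [set a i | i : 'I_n] = [set: X])
    (b_onto : [set b i | i : 'I_n] = [set: X])
    (a_neq_b : forall i, a i <> b i)
    (O : {set X * X}) (defO : O = [set (a i, b i) | i : 'I_n])
    (r0 : {perm X * X}) (r0_Sym : r0 \in Sym O)
    (r0_cycle : forall i, r0 (a i, b i) = (a (ordS i), b (ordS i))) :
  ((exists r : X * X -> X * X, admissible_extension O r0 r) <->
   (forall i, a i = b (ordS i))) /\
  ((forall i, a i = b (ordS i)) -> odd n ->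
   exists! r : X * X -> X * X, admissible_extension O r0 r).
Proof.
case: n n_gt1 cardX a b a_onto b_onto a_neq_b defO r0_cycle => [|[|n]] // _.
move=> cardX a b _ b_onto _ defO r0_cycle.
have [c bK cK] : bijective b.
  apply: inj_card_bij; last by rewrite cardX card_ord.
  suff /imset_injP b_inj : #|[set b i | i : 'I_n.+2]| == #|'I_n.+2|.
    by move=> i j; apply: b_inj.
  by rewrite b_onto cardsT cardX card_ord.
have reindexed : (forall i, a i = b (ordS i)) ->
    O = [set (b (i + 1)%R, b i) | i : 'I_n.+2] /\
    forall i, r0 (b (i + 1)%R, b i) = (b (i + 1 + 1)%R, b (i + 1)%R).
  move=> ab; split.
    by rewrite defO; apply: eq_imset => i; rewrite ab ordS_Zp.
  by move=> i; have := r0_cycle i; rewrite !ab !ordS_Zp.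
split; first split.
- move=> [r [ext [_ _ SD _ _]]] i.
  have : r (a i, b i) = r0 (a i, b i).
    by apply: ext; rewrite defO; apply/imsetP; exists i.
  by rewrite (SD_E SD) r0_cycle => -[].
- move=> /reindexed[EO Er0]; exists (dihedral_map b c).
  exact: dihedral_admissible.
- move=> /reindexed[EO Er0] n_odd; exists (dihedral_map b c).
  split; first exact: dihedral_admissible.
  by move=> r adm; rewrite (admissible_dihedral bK cK EO Er0 n_odd adm).
Qed.
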